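(* There exist sets $A,A'\subset\mathbb{N}$ with $\overline{\mathrm{d}}(A)=2/3$ and $\overline{\mathrm{d}}(A')=5/6$ such that there is no infinite $B\subset\mathbb{N}$ and no number $t\in\mathbb{N}$ with $B+B+t\subset A$, and there is no infinite $B\subset\mathbb{N}$ with $B+B\subset A'$.
   Context: $\mathbb{N}=\{1,2,3,\dots\}$. For $A\subset\mathbb{N}$, the upper density is $\overline{\mathrm{d}}(A)=\limsup_{N\to\infty}\frac{|A\cap[1,N]|}{N}$, where $[1,N]=\{1,\dots,N\}$. $B+B+t=\{b_1+b_2+t : b_1,b_2\in B\}$ (the case $b_1=b_2$ is allowed), and $B+B$ is the case $t=0$. *)

(* Defs.v *)
From mathcomp Require Import all_boot all_order all_algebra finmap.
From mathcomp Require Import all_classical all_reals all_analysis.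

Set Implicit Arguments.
Unset Strict Implicit.
Unset Printing Implicit Defensive.

Import Order.TTheory GRing.Theory Num.Theory.
Import numFieldNormedType.Exports.

Local Open Scope classical_set_scope.
Local Open Scope ring_scope.

(* Here the natural numbers start at 1; subsets of them are sets of nat
   included in [posnat]. *)
Definition posnat : set nat := [set n | (0 < n)%N].

(* The term N = 0 is 0 / 0 = 0 and does not affect the limit superior; the
   sequence takes its values in [0, 1], so the real-valued [limn_sup] is the
   genuine limit superior. *)
Definition upper_density (R : realType) (A : set nat) : R :=
  limn_sup (fun N : nat =>
    #|` fset_set (A `&` [set k | (1 <= k <= N)%N])|%fset%:R / N%:R : R).

Definition sumset_shift (B : set nat) (t : nat) : set nat :=
  [set (b1 + b2 + t)%N | b1 in B & b2 in B].

Definition sumset (B : set nat) : set nat := sumset_shift B 0.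

(* Main.v *)
Require Import Defs.
From mathcomp Require Import all_boot all_order all_algebra.
From mathcomp Require Import all_classical all_reals all_analysis.
From mathcomp Require Import finmap zify ring lra.

Local Open Scope classical_set_scope.
Local Open Scope ring_scope.

Import Order.TTheory GRing.Theory Num.Theory.
Import numFieldNormedType.Exports.

(** Both examples are built from the set A of the integers lying in one of the
    blocks [4^n, 2 * 4^n - 2^n). Up to a negligible number of points, A is
    the union of the intervals [4^n, 2 * 4^n), whose density in [1, N] is
    largest at the right end N = 2 * 4^n of a block, where it tends to
    (4/3) / 2 = 2/3.

    The point of the blocks is that A contains almost no approximate doubles of
    its own elements: if x is in the n-th block then 2x - e lies, for
    fixed e and large n, above the n-th block and below the next one.
    Trimming the last 2^n points of each block is what makes room for the
    shift by e ([in_block_double]).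

    If B + B + t were contained in A, fix b1 in B and take b2 in B very
    large. Then x = b1 + b2 + t is in A, and so is
    2 b2 + t = 2x - (2 b1 + t), which is impossible.

    For the unshifted problem every odd number can be added for free, by
    parity: A' consists of the odd numbers and of the doubles of the elements
    of A, and has upper density 1/2 + (1/2)(2/3) = 5/6. An infinite B
    contains infinitely many elements of the same parity; for two of them,
    b1 and b2 with b2 very large, b1 + b2 and 2 b2 are even, so
    x = (b1 + b2) / 2 and b2 = 2x - b1 are both in A, which is impossible
    again.

    The densities come from explicit counts: an upper bound linear in N for
    all N, and a matching lower bound along the right ends of the blocks
    ([upper_density_of_counts]). *)

(** * Upper densities from counts *)

(** The bound [v] for all indices controls the suprema of the tails of [u] from
    above; the bound [w] needs to hold only along [phi], since every tail
    contains values of [u \o phi] arbitrarily far out. *)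
Lemma limn_sup_squeeze (R : realType) (u v w : nat -> R) (phi : nat -> nat)
    (l : R) :
  (forall n, u n <= v n) -> (forall n, (n <= phi n)%N) ->
  (forall n, w n <= u (phi n)) ->
  v @ \oo --> l -> w @ \oo --> l -> limn_sup u = l.
Proof.
move=> uv phin wu vl wl.
have v_ub : has_ubound (range v).
  exact/bounded_fun_has_ubound/cvg_seq_bounded/cvgP/vl.
have u_ub : has_ubound (range u).
  have [M vM] := v_ub; exists M => _ [n _ <-].
  by apply: (le_trans (uv n)); apply: vM; exists n.
apply/cvg_lim => //.
apply: (squeeze_cvgr _ (cvg_cst l) (cvg_sups vl)).
apply: nearW => n; apply/andP; split.
- apply: (cvgr_to_le wl); near=> m.
  apply: (le_trans (wu m)); apply: ub_le_sup; first exact: has_ubound_sdrop.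
  exists (phi m) => //=; apply: leq_trans (phin m).
  by near: m; exact: nbhs_infty_ge.
- apply: ge_sup; first by exists (u n); exists n => /=.
  move=> _ [m /= nm <-]; apply: (le_trans (uv m)); apply: ub_le_sup.
    exact: has_ubound_sdrop.
  by exists m.
Unshelve. all: by end_near. Qed.

Lemma card_initial_segment (P : pred nat) (N : nat) : P 0%N = false ->
  #|` fset_set ([set k | P k] `&` [set k | (1 <= k <= N)%N])|%fset =
  count P (iota 0 N.+1).
Proof.
move=> P0.
have mem_seg k : (k \in [seq k <- iota 0 N.+1 | P k]) = P k && (1 <= k <= N)%N.
  by rewrite mem_filter mem_iota; case: k => [|k]; rewrite ?P0.
have -> : [set k | P k] `&` [set k | (1 <= k <= N)%N] =
    [set` [fset k in [seq k <- iota 0 N.+1 | P k]]%fset].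
  by apply/seteqP; split=> k; rewrite /mkset in_fset mem_seg => /andP.
by rewrite set_fsetK card_fseq undup_id ?filter_uniq ?iota_uniq// size_filter.
Qed.

(** This keeps all the counting in [nat]. The errors allowed are those of the
    trimmed blocks: with [phi n] at least [4 ^ n], a defect of order [2 ^ n] is
    negligible. *)
Lemma upper_density_of_counts (R : realType) (P : pred nat) (p q K c : nat)
    (phi : nat -> nat) :
  P 0%N = false -> (0 < q)%N ->
  (forall N, (q * count P (iota 0 N.+1) <= p * N + K)%N) ->
  (forall n, (4 ^ n <= phi n)%N) ->
  (forall n, (p * phi n <= q * count P (iota 0 (phi n).+1) + c * 2 ^ n)%N) ->
  upper_density R [set k | P k] = p%:R / q%:R.
Proof.
move=> P0 q0 above phi4 below.
have qR : 0 < q%:R :> R by rewrite ltr0n.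
rewrite /upper_density.
under [X in limn_sup X]eq_fun do rewrite card_initial_segment//.
apply: (@limn_sup_squeeze _ _ (fun n => p%:R / q%:R + K%:R / q%:R * n%:R^-1)
  (fun n => p%:R / q%:R - c%:R / q%:R * 2^-1 ^+ n) phi).
- case=> [|n]; first by rewrite invr0 !mulr0 addr0 divr_ge0.
  rewrite ler_pdivrMr ?ltr0n// mulrDl mulfVK ?pnatr_eq0//.
  rewrite mulrAC -mulrDl ler_pdivlMr// mulrC -!natrM -natrD ler_nat.
  exact: above.
- by move=> n; apply: leq_trans (phi4 n); apply/ltnW/ltn_expl.
- move=> n; have phi0 : (0 < phi n)%N.
    by apply: leq_trans (phi4 n); rewrite expn_gt0.
  rewrite ler_pdivlMr ?ltr0n// mulrBl lerBlDr.
  rewrite mulrAC ler_pdivrMr// mulrDl.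
  have hp : 2 ^+ n <= 2^-1 ^+ n * (phi n)%:R :> R.
    rewrite exprVn ler_pdivlMl ?exprn_gt0// -exprMn -natrM -natrX ler_nat.
    exact: phi4.
  have := below n; rewrite -(ler_nat R) natrD !natrM natrX => /le_trans; apply.
  rewrite mulrC lerD2l.
  have -> : c%:R / q%:R * 2^-1 ^+ n * (phi n)%:R * q%:R =
    c%:R * (2^-1 ^+ n * (phi n)%:R) :> R.
    by field; rewrite gt_eqF.
  exact: ler_wpM2l.
- rewrite -[X in _ --> X]addr0; apply: cvgD; first exact: cvg_cst.
  rewrite -[X in _ --> X](mulr0 (K%:R / q%:R)); apply: cvgMl_tmp.
  by apply/gtr0_cvgV0; [exists 1%N => // n /= n0; rewrite ltr0n|exact: cvgr_idn].
- rewrite -[X in _ --> X]subr0; apply: cvgB; first exact: cvg_cst.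
  rewrite -[X in _ --> X](mulr0 (c%:R / q%:R)); apply: cvgMl_tmp.
  by apply: cvg_expr; rewrite ger0_norm; lra.
Qed.

(** * The blocks [4^n, 2 * 4^n - 2^n) *)

(** [trunc_log 4 k] is the only index n for which the n-th block can contain
    k. *)
Definition in_block (k : nat) : bool :=
  (0 < k)%N && (k + 2 ^ trunc_log 4 k < 2 * 4 ^ trunc_log 4 k)%N.

Lemma in_blockE (n k : nat) : (4 ^ n <= k < 4 ^ n.+1)%N ->
  in_block k = (k + 2 ^ n < 2 * 4 ^ n)%N.
Proof.
move=> kn; rewrite /in_block (@trunc_log_eq 4 n k)//.
by case/andP: kn => nk _; rewrite (leq_trans _ nk)// expn_gt0.
Qed.

Lemma leq_pow2_pow4 (n : nat) : (2 ^ n <= 4 ^ n)%N.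
Proof. by case: n => // n; rewrite leq_exp2r. Qed.

(** Write n for the index of the block of [x]. Since x >= 4^n and e < 2^n, the
    number y = 2x - e is at least 2 * 4^n - 2^n, the end of that block; since
    x < 2 * 4^n, it is less than 4^(n+1), where the next one begins. *)
Lemma in_block_double (x y e : nat) : in_block x -> (4 ^ e <= x)%N ->
  (y + e = 2 * x)%N -> ~~ in_block y.
Proof.
move=> bx ex yx.
have x0 : (0 < x)%N by apply: leq_trans ex; rewrite expn_gt0.
have := @trunc_log_bounds 4 x isT x0; have := @trunc_log_max 4 x e isT ex.
set n := trunc_log 4 x => /= en xn.
move: bx; rewrite (in_blockE _ _ xn) => bx.
have e2 : (e < 2 ^ n)%N by apply: leq_ltn_trans en _; exact: ltn_expl.
rewrite expnS in xn.
have n24 := leq_pow2_pow4 n.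
rewrite (in_blockE n) ?expnS; lia.
Qed.

Lemma count_block_low (n M : nat) : (M <= 4 ^ n - 2 ^ n)%N ->
  count in_block (iota (4 ^ n) M) = M.
Proof.
move=> Mn; rewrite -[RHS](size_iota (4 ^ n) M) -count_predT.
apply: eq_in_count => k; rewrite mem_iota => kM /=.
by rewrite (in_blockE n) ?expnS; lia.
Qed.

Lemma count_block_high (n M : nat) : (4 ^ n - 2 ^ n + M <= 3 * 4 ^ n)%N ->
  count in_block (iota (4 ^ n + (4 ^ n - 2 ^ n)) M) = 0%N.
Proof.
move=> Mn; rewrite -[RHS](count_pred0 (iota (4 ^ n + (4 ^ n - 2 ^ n)) M)).
apply: eq_in_count => k; rewrite mem_iota => kM /=.
have n24 := leq_pow2_pow4 n.
by rewrite (in_blockE n) ?expnS; lia.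
Qed.

(** The sum over j < n of the block lengths 4^j - 2^j, with the geometric
    series cleared of denominators and of subtractions. *)
Lemma count_below_pow4 (n : nat) :
  (3 * count in_block (iota 0 (4 ^ n)) + 3 * 2 ^ n = 4 ^ n + 2)%N.
Proof.
elim: n => [//|n IHn]; have n24 := leq_pow2_pow4 n.
have -> : (4 ^ n.+1 = 4 ^ n + ((4 ^ n - 2 ^ n) + (2 * 4 ^ n + 2 ^ n)))%N.
  by rewrite expnS; lia.
rewrite iotaD count_cat iotaD count_cat add0n.
rewrite count_block_low// count_block_high ?expnS; lia.
Qed.

(** Inside a block the count grows at rate 1 > 2/3 and in the following gap at
    rate 0, so that the worst case is the end of a block, where
    [count_below_pow4] gives the bound. *)
Lemma count_in_block_le (N : nat) :
  (3 * count in_block (iota 0 N.+1) <= 2 * N + 1)%N.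
Proof.
case: N => [//|N]; pose n := trunc_log 4 N.+1.
have Nn : (4 ^ n <= N.+1 < 4 ^ n.+1)%N by exact: trunc_log_bounds.
rewrite expnS in Nn.
have IHn := count_below_pow4 n; have n24 := leq_pow2_pow4 n.
have n0 : (0 < 2 ^ n)%N by rewrite expn_gt0.
have [NM|MN] := leqP N.+2 (4 ^ n + (4 ^ n - 2 ^ n)).
  have -> : N.+2 = (4 ^ n + (N.+2 - 4 ^ n))%N by lia.
  rewrite iotaD count_cat add0n count_block_low; lia.
have -> : N.+2 = (4 ^ n + ((4 ^ n - 2 ^ n) +
  (N.+2 - (4 ^ n + (4 ^ n - 2 ^ n)))))%N by lia.
rewrite iotaD count_cat iotaD count_cat add0n.
rewrite count_block_low// count_block_high; lia.
Qed.

Lemma count_below_block_end (n : nat) :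
  (3 * count in_block (iota 0 (2 * 4 ^ n)) + 6 * 2 ^ n = 4 * 4 ^ n + 2)%N.
Proof.
have IHn := count_below_pow4 n; have n24 := leq_pow2_pow4 n.
have -> : (2 * 4 ^ n = 4 ^ n + ((4 ^ n - 2 ^ n) + 2 ^ n))%N by lia.
rewrite iotaD count_cat iotaD count_cat add0n.
rewrite count_block_low// count_block_high; lia.
Qed.

Lemma leq_count_iota (P : pred nat) (m n : nat) : (m <= n)%N ->
  (count P (iota 0 m) <= count P (iota 0 n))%N.
Proof. by move=> /subnKC <-; rewrite iotaD count_cat leq_addr. Qed.

Lemma upper_density_blocks (R : realType) :
  upper_density R [set k | in_block k] = 2 / 3.
Proof.
apply: (@upper_density_of_counts R in_block 2 3 1 6 (fun n => 2 * 4 ^ n)%N) => //.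
- exact: count_in_block_le.
- by move=> n; lia.
- move=> n; have := count_below_block_end n.
  have := @leq_count_iota in_block _ _ (leqnSn (2 * 4 ^ n)); lia.
Qed.

(** * Adding the odd numbers *)

Definition odd_or_double (P : pred nat) : pred nat :=
  fun k => odd k || P k./2.

(** Each pair 2j, 2j + 1 contributes 1 for its odd element, and one more exactly
    when j satisfies [P]. *)
Lemma count_odd_or_double (P : pred nat) (M : nat) :
  count (odd_or_double P) (iota 0 (2 * M)) = (M + count P (iota 0 M))%N.
Proof.
elim: M => [//|M IHM].
have -> : (2 * M.+1 = 2 * M + 2)%N by lia.
rewrite (iotaD 0 (2 * M) 2) count_cat IHM -[in RHS]addn1 (iotaD 0 M 1) count_cat.
rewrite /= /odd_or_double !add0n mul2n /= !odd_double doubleK uphalf_double /=.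
lia.
Qed.

Lemma upper_density_odd_or_double_blocks (R : realType) :
  upper_density R [set k | odd_or_double in_block k] = 5 / 6.
Proof.
apply: (@upper_density_of_counts R _ 5 6 8 12 (fun n => 2 * (2 * 4 ^ n))%N) => //.
- (* The pairs 2j, 2j + 1 with j <= N/2 cover 0, ..., N. *)
  move=> N; have le_cover : (N.+1 <= 2 * (N./2).+1)%N by lia.
  have := @leq_count_iota (odd_or_double in_block) _ _ le_cover.
  rewrite count_odd_or_double; have := count_in_block_le N./2; lia.
- by move=> n; lia.
- move=> n; have := count_below_block_end n.
  have := @leq_count_iota (odd_or_double in_block) _ _
    (leqnSn (2 * (2 * 4 ^ n))).
  rewrite count_odd_or_double; lia.
Qed.

(** * Infinite sets of integers and their sums *)

Lemma infinite_set_unbounded (B : set nat) (m : nat) : infinite_set B ->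
  exists2 b, B b & (m <= b)%N.
Proof.
move=> Binf; apply: contrapT => noB; apply: Binf.
apply: sub_finite_set (finite_II m) => b Bb /=.
by rewrite ltnNge; apply/negP => mb; apply: noB; exists b.
Qed.

Lemma infinite_set_parity (B : set nat) : infinite_set B ->
  exists p : bool, forall m, exists b, [/\ B b, (m <= b)%N & odd b = p].
Proof.
move=> Binf; have [?|/existsNP[m0 noodd]] :=
  pselect (forall m, exists b, [/\ B b, (m <= b)%N & odd b = true]).
  by exists true.
exists false => m; have [b Bb mb] := infinite_set_unbounded B (maxn m m0) Binf.
exists b; split=> //; first by lia.
by apply/negP => ob; apply: noodd; exists b; split=> //; lia.
Qed.

Theorem proposition4p1 (R : realType) :
  exists A A' : set nat,
    [/\ A `<=` posnat /\ A' `<=` posnat,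
        upper_density R A = 2 / 3,
        upper_density R A' = 5 / 6,
        ~ (exists (B : set nat) (t : nat),
             [/\ B `<=` posnat, infinite_set B, posnat t &
                 sumset_shift B t `<=` A])
      & ~ (exists B : set nat,
             [/\ B `<=` posnat, infinite_set B & sumset B `<=` A'])].
Proof.
exists [set k | in_block k], [set k | odd_or_double in_block k].
split.
- by split; case.
- exact: upper_density_blocks.
- exact: upper_density_odd_or_double_blocks.
- move=> [B [t [_ Binf _ BA]]].
  have [b1 Bb1 _] := infinite_set_unbounded B 0 Binf.
  (* 2 b2 + t = 2 (b1 + b2 + t) - e *)
  pose e := (2 * b1 + t)%N.
  have [b2 Bb2 eb2] := infinite_set_unbounded B (4 ^ e) Binf.
  have A12 : in_block (b1 + b2 + t)%N by apply: BA; exists b1 => //; exists b2.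
  have A22 : in_block (b2 + b2 + t)%N by apply: BA; exists b2 => //; exists b2.
  apply/negP: A22; apply: (@in_block_double (b1 + b2 + t)%N _ e) => //; lia.
- move=> [B [_ Binf BA]].
  have [p Bp] := infinite_set_parity B Binf.
  have [b1 [Bb1 _ ob1]] := Bp 0%N.
  have [b2 [Bb2 eb2 ob2]] := Bp (2 * 4 ^ b1)%N.
  have A12 : odd_or_double in_block (b1 + b2 + 0)%N.
    by apply: BA; exists b1 => //; exists b2.
  have A22 : odd_or_double in_block (b2 + b2 + 0)%N.
    by apply: BA; exists b2 => //; exists b2.
  move: A12 A22; rewrite /odd_or_double !addn0 !oddD ob1 ob2 addbb /=.
  rewrite addnn doubleK => A12; apply/negP.
  (* b2 = 2 ((b1 + b2) / 2) - b1, as b1 + b2 is even. *)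
  by apply: (@in_block_double (b1 + b2)%N./2 _ b1) => //; lia.
Qed.
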